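(* Let $X$ be an arbitrary set, and let $(K_x)_{x\in X}$ be a family of nonzero finite dimensional complex Banach spaces. Let $B=\prod_{x\in X}B(K_x)$. Denote by $[\pi]$ the equivalence class of an irreducible representation $\pi$ of $B$ on a nonzero Banach space, let $\mathcal{E}$ be the collection of all such equivalence classes (for all nonzero Banach spaces), and let $\mathcal{F}$ be the set of all $\sigma$-complete ultrafilters over $X$. Then the assignments $$\mathcal{E}\to\mathcal{F},\quad [\pi]\mapsto F_\pi,\qquad\text{and}\qquad \mathcal{F}\to\mathcal{E},\quad F\mapsto[\pi_F],$$ are well defined (in particular $[\pi_F]$ does not depend on the bases chosen to construct $\pi_F$) and are inverse to each other. Hence the equivalence classes of irreducible representations of $B$ are in one-to-one correspondence with the $\sigma$-complete ultrafilters over $X$.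
   Context: For a complex Banach space $K$, $B(K)$ is the Banach algebra of bounded operators on $K$. $B=\prod_{x\in X}B(K_x)$ is the unrestricted algebraic direct product: all functions $b$ on $X$ with $b(x)\in B(K_x)$ for every $x$ (no boundedness condition), a unital algebra under pointwise operations. A representation of $B$ on a Banach space $K$ is a unital algebra homomorphism $\pi:B\to B(K)$ (no continuity assumed). Two representations are equivalent if there is an invertible (bounded, with bounded inverse) intertwiner between them. A representation $\pi$ on $K$ is irreducible if the only idempotents $e\in B(K)$ (not necessarily self-adjoint) commuting with all $\pi(b)$, $b\in B$, are $0$ and the identity. A filter over $X$ is a collection $F$ of nonempty subsets of $X$ that contains $X$, is closed under finite intersections and under passing to supersets in $X$. It is an ultrafilter if for each $U\subset X$ either $U\in F$ or $U^c\in F$. It is $\sigma$-complete if it is closed under countable intersections. (Principal ultrafilters are allowed.) For $U\subset X$, $\chi_U\in B$ is defined by $\chi_U(x)=I_x$ (the identity of $B(K_x)$) if $x\in U$ and $\chi_U(x)=0$ otherwise. For an irreducible representation $\pi$ of $B$ on $K$, $$F_\pi=\{U\subset X : \pi(\chi_U)=I_\pi\},$$ where $I_\pi$ is the identity of $B(K)$. Definition of $\pi_F$ for a $\sigma$-complete ultrafilter $F$ over $X$: let $\Omega_n=\{x\in X:\dim K_x=n\}$ and let $n(F)$ be the unique natural number with $\Omega_{n(F)}\in F$. Choose a basis of each $K_x$; for $b\in B$ let $b(x)_{ij}$ be the matrix entries of $b(x)$ in the chosen basis of $K_x$. For $M\in B(\mathbb{C}^{m})$ let $M_{ij}$ be its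 entries in the standard basis. For $b\in B$ let $M(b)$ be the unique $M\in B(\mathbb{C}^{n(F)})$ such that $\{x\in\Omega_{n(F)} : b(x)_{ij}=M_{ij}\text{ for all }i,j\}\in F$. Then $\pi_F:B\to B(\mathbb{C}^{n(F)})$ is defined by $\pi_F(b)=M(b)$. *)

(* Defs.v *)
From HB Require Import structures.
From mathcomp Require Import all_boot all_order all_algebra complex.
From mathcomp Require Import all_classical all_reals all_analysis.
Set Implicit Arguments.
Unset Strict Implicit.
Unset Printing Implicit Defensive.
Import Order.TTheory GRing.Theory Num.Theory.
Import numFieldNormedType.Exports.
Local Open Scope classical_set_scope.
Local Open Scope ring_scope.
Local Open Scope complex_scope.

HB.instance Definition _ (R : rcfType) := PseudoPointedMetric.copy R[i] R[i]^o.

Lemma complex_complete (R : realType) (F : set_system R[i]) :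
  ProperFilter F -> cauchy F -> cvg F.
Proof.
move=> FF /cauchy_ballP F_cauchy.
have part (p : R[i] -> R) : (forall z w, `|p z - p w|%:C <= `|z - w|) ->
    cvg (p @ F).
  move=> p_le; apply/cauchy_cvgP/cauchy_ballP => e e0.
  have e0C : 0 < e%:C by rewrite ltcR.
  have := F_cauchy _ e0C.
  rewrite /nbhs_ball /prod_topology.
  case=> -[A B] /= [FA FB] AB.
  exists (p @` A, p @` B) => /=.
    split.
      apply: filterS FA => z Az; by exists z.
    apply: filterS FB => z Bz; by exists z.
  move=> [_ _] /= [[z Az <-] [w Bw <-]].
  rewrite /ball /= -ltcR.
  exact: le_lt_trans (p_le _ _) (AB (z, w) (conj Az Bw)).
have /cvg_ex[a aP] : cvg ((@complex.Re R) @ F).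
  apply: part => z w; rewrite -raddfB; exact: normc_ge_Re.
have /cvg_ex[b bP] : cvg ((@complex.Im R) @ F).
  apply: part => -[z1 z2] [w1 w2] /=; rewrite normc_def /= lecR.
  by rewrite -sqrtr_sqr ler_sqrt ?addr_ge0 ?sqr_ge0// lerDr sqr_ge0.
apply/cvg_ex; exists (a +i* b).
apply/(@cvgrPdist_lt _ R[i]^o) => /= e e0.
have [r r0 re] : exists2 r : R, 0 < r & (r + r)%:C = e.
  case: e e0 => e1 e2; rewrite ltcE /= => /andP[/eqP -> e10].
  by exists (e1 / 2); rewrite ?divr_gt0// -splitr.
move/(@cvgrPdist_lt _ R^o)/(_ r r0) : aP => Ha.
move/(@cvgrPdist_lt _ R^o)/(_ r r0) : bP => Hb.
move: Ha Hb; rewrite !near_simpl => Ha Hb.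
apply: filterS2 Ha Hb => -[x y] /= xa yb.
rewrite -re rmorphD /=.
have -> : (a +i* b) - (x +i* y) = (a - x)%:C + 'i * (b - y)%:C.
  by apply/eqP; rewrite eq_complex /=; apply/andP; split; apply/eqP;
    rewrite /= !(mul0r, mul1r, mulr0, subr0, add0r, addr0).
apply: le_lt_trans (ler_normD _ _) _; rewrite normrM normCi mul1r.
by rewrite !normc_def /= !expr0n /= !addr0 !sqrtr_sqr; apply: ltrD; rewrite ltcR.
Qed.

HB.instance Definition _ (R : realType) :=
  Uniform_isComplete.Build R[i] (@complex_complete R).

(* The library instance for matrices over a complete space does not trigger the
   join with NormedModule; this one makes 'M[R[i]]_(m, n) a Banach space. *)
HB.instance Definition _ (R : realType) (m n : nat) :=
  Uniform_isComplete.Build 'M[R[i]]_(m, n) cauchy_cvg.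

#[short(type="finDimBanachType")]
HB.structure Definition FinDimBanach (K : numFieldType) :=
  {V of CompleteNormedModule K V & Vector K V}.

(* The algebra B(V). It has no nzRingType structure, hence no algType
   structure, because V may be 0; the ring and module structures are declared
   separately. *)

Section BoundedOperators.
Variable C : numFieldType.

Definition bounded_op (V W : normedModType C) (f : V -> W) : Prop :=
  exists M : C, forall v, `|f v| <= M * `|v|.

Lemma bounded_op_comp (U V W : normedModType C) (f : {linear V -> W})
    (g : {linear U -> V}) :
  bounded_op f -> bounded_op g -> bounded_op (f \o g).
Proof.
move=> [M fM] [N gN]; exists (`|M| * N) => v /=.
have [->|g0] := eqVneq (g v) 0.
  rewrite linear0 normr0 -mulrA mulr_ge0//.
  exact: le_trans (gN v).
have M0 : 0 <= M.
  by have := le_trans (normr_ge0 _) (fM (g v)); rewrite pmulr_lge0// normr_gt0.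
by rewrite ger0_norm// -mulrA (le_trans (fM _))// ler_wpM2l.
Qed.

Record bop (V : normedModType C) := Bop {
  bop_fun :> V -> V;
  bop_linear : linear bop_fun;
  bop_bounded : bounded_op bop_fun }.

Variable V : normedModType C.
Implicit Types f g h : bop V.

HB.instance Definition _ f :=
  GRing.isLinear.Build C V V *:%R (bop_fun f) (bop_linear f).

Lemma bopP f g : (forall v, f v = g v) <-> f = g.
Proof.
split=> [|-> //]; case: f g => [f fl fb] [g gl gb] /= /funext fg.
case: _ / fg in gl gb *; congr Bop; exact: Prop_irrelevance.
Qed.

HB.instance Definition _ := gen_eqMixin (bop V).
HB.instance Definition _ := gen_choiceMixin (bop V).

Lemma bounded_op0 : bounded_op (\0 : V -> V).
Proof. by exists 0 => v; rewrite normr0 mul0r. Qed.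

Lemma bounded_op1 : bounded_op (idfun : V -> V).
Proof. by exists 1 => v; rewrite mul1r. Qed.

Lemma bounded_opN f : bounded_op (\- f).
Proof. by case: (bop_bounded f) => M fM; exists M => v; rewrite normrN. Qed.

Lemma bounded_opD f g : bounded_op (f \+ g).
Proof.
case: (bop_bounded f) (bop_bounded g) => [M fM] [N gN]; exists (M + N) => v.
by rewrite mulrDl (le_trans (ler_normD _ _))// lerD.
Qed.

Lemma bounded_opZ (a : C) f : bounded_op (a \*: f).
Proof.
case: (bop_bounded f) => [M fM]; exists (`|a| * M) => v.
by rewrite normrZ -mulrA ler_wpM2l.
Qed.

Definition bop0 : bop V := Bop (@linearP _ _ _ _ \0) bounded_op0.
Definition bop1 : bop V := Bop (@linearP _ _ _ _ idfun) bounded_op1.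
Definition bop_opp f : bop V := Bop (@linearP _ _ _ _ (\- f)) (bounded_opN f).
Definition bop_add f g : bop V :=
  Bop (@linearP _ _ _ _ (f \+ g)) (bounded_opD f g).
Definition bop_scale (a : C) f : bop V :=
  Bop (@linearP _ _ _ _ (a \*: f)) (bounded_opZ a f).
Definition bop_mul f g : bop V :=
  Bop (@linearP _ _ _ _ (f \o g)) 
    (bounded_op_comp (bop_bounded f) (bop_bounded g)).

Lemma bop_addA : associative bop_add.
Proof. by move=> f g h; apply/bopP => v /=; rewrite addrA. Qed.
Lemma bop_addC : commutative bop_add.
Proof. by move=> f g; apply/bopP => v /=; rewrite addrC. Qed.
Lemma bop_add0 : left_id bop0 bop_add.
Proof. by move=> f; apply/bopP => v /=; rewrite add0r. Qed.
Lemma bop_addN : left_inverse bop0 bop_opp bop_add.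
Proof. by move=> f; apply/bopP => v /=; rewrite addNr. Qed.

HB.instance Definition _ :=
  GRing.isZmodule.Build (bop V) bop_addA bop_addC bop_add0 bop_addN.

Lemma bop_mulA : associative bop_mul.
Proof. by move=> f g h; apply/bopP. Qed.
Lemma bop_mul1l : left_id bop1 bop_mul.
Proof. by move=> f; apply/bopP. Qed.
Lemma bop_mul1r : right_id bop1 bop_mul.
Proof. by move=> f; apply/bopP. Qed.
Lemma bop_mulDl : left_distributive bop_mul bop_add.
Proof. by move=> f g h; apply/bopP. Qed.
Lemma bop_mulDr : right_distributive bop_mul bop_add.
Proof. by move=> f g h; apply/bopP => v /=; rewrite linearD. Qed.

HB.instance Definition _ := GRing.Zmodule_isPzRing.Build (bop V)
  bop_mulA bop_mul1l bop_mul1r bop_mulDl bop_mulDr.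

Lemma bop_scaleA (a b : C) f :
  bop_scale a (bop_scale b f) = bop_scale (a * b) f.
Proof. by apply/bopP => v /=; rewrite scalerA. Qed.
Lemma bop_scale1 : left_id 1 bop_scale.
Proof. by move=> f; apply/bopP => v /=; rewrite scale1r. Qed.
Lemma bop_scaleDr : right_distributive bop_scale +%R.
Proof. by move=> a f g; apply/bopP => v /=; rewrite scalerDr. Qed.
Lemma bop_scaleDl f : {morph bop_scale^~ f : a b / a + b}.
Proof. by move=> a b; apply/bopP => v /=; rewrite scalerDl. Qed.

HB.instance Definition _ := GRing.Zmodule_isLmodule.Build C (bop V)
  bop_scaleA bop_scale1 bop_scaleDr bop_scaleDl.

End BoundedOperators.

(* The algebra B = \prod_x B(K_x), without boundedness condition. *)

Section ProductAlgebra.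
Variables (C : numFieldType) (X : Type) (K : X -> finDimBanachType C).

Definition bprod := forall x, bop (K x).
Implicit Types b c d : bprod.

HB.instance Definition _ := gen_eqMixin bprod.
HB.instance Definition _ := gen_choiceMixin bprod.

Definition bprod0 : bprod := fun=> 0.
Definition bprod1 : bprod := fun=> 1.
Definition bprod_opp b : bprod := fun x => - b x.
Definition bprod_add b c : bprod := fun x => b x + c x.
Definition bprod_mul b c : bprod := fun x => b x * c x.
Definition bprod_scale (a : C) b : bprod := fun x => a *: b x.

Lemma bprod_addA : associative bprod_add.
Proof. by move=> b c d; apply: functional_extensionality_dep => x; exact: addrA. Qed.
Lemma bprod_addC : commutative bprod_add.
Proof. by move=> b c; apply: functional_extensionality_dep => x; exact: addrC. Qed.
Lemma bprod_add0 : left_id bprod0 bprod_add.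
Proof. by move=> b; apply: functional_extensionality_dep => x; exact: add0r. Qed.
Lemma bprod_addN : left_inverse bprod0 bprod_opp bprod_add.
Proof. by move=> b; apply: functional_extensionality_dep => x; exact: addNr. Qed.

HB.instance Definition _ :=
  GRing.isZmodule.Build bprod bprod_addA bprod_addC bprod_add0 bprod_addN.

Lemma bprod_mulA : associative bprod_mul.
Proof. by move=> b c d; apply: functional_extensionality_dep => x; exact: mulrA. Qed.
Lemma bprod_mul1l : left_id bprod1 bprod_mul.
Proof. by move=> b; apply: functional_extensionality_dep => x; exact: mul1r. Qed.
Lemma bprod_mul1r : right_id bprod1 bprod_mul.
Proof. by move=> b; apply: functional_extensionality_dep => x; exact: mulr1. Qed.
Lemma bprod_mulDl : left_distributive bprod_mul bprod_add.
Proof. by move=> b c d; apply: functional_extensionality_dep => x; exact: mulrDl. Qed.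
Lemma bprod_mulDr : right_distributive bprod_mul bprod_add.
Proof. by move=> b c d; apply: functional_extensionality_dep => x; exact: mulrDr. Qed.

HB.instance Definition _ := GRing.Zmodule_isPzRing.Build bprod
  bprod_mulA bprod_mul1l bprod_mul1r bprod_mulDl bprod_mulDr.

Lemma bprod_scaleA (a a' : C) b :
  bprod_scale a (bprod_scale a' b) = bprod_scale (a * a') b.
Proof. by apply: functional_extensionality_dep => x; exact: scalerA. Qed.
Lemma bprod_scale1 : left_id 1 bprod_scale.
Proof. by move=> b; apply: functional_extensionality_dep => x; exact: scale1r. Qed.
Lemma bprod_scaleDr : right_distributive bprod_scale +%R.
Proof. by move=> a b c; apply: functional_extensionality_dep => x; exact: scalerDr. Qed.
Lemma bprod_scaleDl b : {morph bprod_scale^~ b : a a' / a + a'}.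
Proof. by move=> a a'; apply: functional_extensionality_dep => x; exact: scalerDl. Qed.

HB.instance Definition _ := GRing.Zmodule_isLmodule.Build C bprod
  bprod_scaleA bprod_scale1 bprod_scaleDr bprod_scaleDl.

Definition chi (U : set X) : bprod := fun x => if x \in U then 1 else 0.

End ProductAlgebra.

Section Representations.
Variables (R : realType) (X : Type) (K : X -> finDimBanachType R[i]).

Definition representation (V : completeNormedModType R[i])
    (pi : bprod K -> bop V) : Prop :=
  linear pi /\ monoid_morphism pi.

Definition irreducible (V : completeNormedModType R[i])
    (pi : bprod K -> bop V) : Prop :=
  forall e : bop V, e * e = e -> (forall b, GRing.comm e (pi b)) ->
    e = 0 \/ e = 1.

Definition irreducible_rep (V : completeNormedModType R[i])
    (pi : bprod K -> bop V) : Prop :=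
  [/\ exists v : V, v != 0, representation pi & irreducible pi].

Record irrep := Irrep {
  irrep_space : completeNormedModType R[i];
  irrep_fun :> bprod K -> bop irrep_space;
  irrepP : irreducible_rep irrep_fun }.

Definition rep_equiv (pi rho : irrep) : Prop :=
  exists (T : {linear irrep_space pi -> irrep_space rho})
         (S : {linear irrep_space rho -> irrep_space pi}),
    [/\ bounded_op T, bounded_op S, cancel T S, cancel S T &
        forall b v, T (pi b v) = rho b (T v)].

Lemma rep_equiv_refl pi : rep_equiv pi pi.
Proof. by exists idfun, idfun; split=> //; exact: bounded_op1. Qed.

Lemma rep_equiv_sym pi rho : rep_equiv pi rho -> rep_equiv rho pi.
Proof.
move=> [T [S [Tb Sb TK SK TE]]]; exists S, T; split=> // b v.
by rewrite -{1}(SK v) -TE TK.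
Qed.

Lemma rep_equiv_trans pi rho tau :
  rep_equiv pi rho -> rep_equiv rho tau -> rep_equiv pi tau.
Proof.
move=> [T [S [Tb Sb TK SK TE]]] [T' [S' [Tb' Sb' TK' SK' TE']]].
exists (T' \o T), (S \o S'); split.
- exact: bounded_op_comp.
- exact: bounded_op_comp.
- by move=> v /=; rewrite TK' TK.
- by move=> v /=; rewrite SK SK'.
- by move=> b v /=; rewrite TE TE'.
Qed.

(* A class is represented by the predicate "being equivalent to pi". *)
Definition rep_class := {E : irrep -> Prop | exists pi, E = rep_equiv pi}.

Definition class_of (pi : irrep) : rep_class :=
  exist _ (rep_equiv pi) (ex_intro _ pi erefl).

Lemma class_ofP (pi rho : irrep) :
  class_of pi = class_of rho <-> rep_equiv pi rho.
Proof.
split=> [[/(congr1 (@^~ rho)) ->]|pi_rho]; first exact: rep_equiv_refl.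
apply: eq_exist; apply: funext => s; apply: propext; split=> ?.
  exact: rep_equiv_trans (rep_equiv_sym pi_rho) _.
exact: rep_equiv_trans pi_rho _.
Qed.

Definition filter_of_rep (pi : irrep) : set_system X :=
  [set U | pi (chi K U) = 1].

End Representations.

Record sigma_complete_ultrafilter (X : Type) (F : set_system X) : Prop := {
  scu_filter : ProperFilter F;
  scu_ultra : forall U : set X, F U \/ F (~` U);
  scu_sigma : forall U : nat -> set X,
    (forall k, F (U k)) -> F (\bigcap_k U k) }.

Definition sigma_ultrafilter (X : Type) :=
  {F : set_system X | sigma_complete_ultrafilter F}.

(* The bounded operator on C^n with matrix M in the standard basis. C^n carries
   the max norm; since all norms on C^n are equivalent, B(C^n) does not depend
   on this choice. *)

Section MatrixOperator.
Variables (R : realType) (n : nat).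

Lemma mulmx_bounded (M : 'M[R[i]]_n) :
  bounded_op (mulmx M : 'cV[R[i]]_n -> 'cV[R[i]]_n).
Proof.
exists (\sum_i \sum_j `|M i j|) => v.
have vle j : `|v j 0| <= `|v|.
  rewrite [leRHS]/Num.Def.normr /= mx_normE -[leLHS]nngE num_le.
  exact: (le_bigmax _ _ (j, 0)).
have S0 : 0 <= \sum_i \sum_j `|M i j|.
  by apply: sumr_ge0 => i _; exact: sumr_ge0.
rewrite [leLHS]/Num.Def.normr /=; have [->|] := eqVneq (mx_norm (M *m v)) 0.
  by rewrite mulr_ge0.
move=> /mx_norm_neq0[[i k] ->] /=; rewrite (ord1 k) mxE.
apply: le_trans (ler_norm_sum _ _ _) _.
apply: (@le_trans _ _ (\sum_j `|M i j| * `|v|)).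
  by apply: ler_sum => j _; rewrite normrM ler_wpM2l.
rewrite -mulr_suml ler_wpM2r// [leRHS](bigD1 i)//= lerDl.
by apply: sumr_ge0 => l _; exact: sumr_ge0.
Qed.

Definition mx_op (M : 'M[R[i]]_n) :
    bop ('cV[R[i]]_n : completeNormedModType R[i]) :=
  Bop (@linearP _ _ _ _ (mulmx M)) (mulmx_bounded M).

End MatrixOperator.

Section RepOfFilter.
Variables (R : realType) (X : Type) (K : X -> finDimBanachType R[i]).
Variable F : set_system X.

Definition Omega (n : nat) : set X := [set x | \dim {: K x} = n].

Definition dim_of_filter : nat := xget 0%N [set n | F (Omega n)].

Variable e : forall x, (\dim {: K x}).-tuple (K x).

Definition is_basis_family : Prop := forall x, basis_of fullv (e x).

Definition entry (b : bprod K) (x : X) (i j : 'I_(\dim {: K x})) : R[i] :=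
  coord (e x) i (b x (tnth (e x) j)).

(* The set of those x in Omega n such that b(x) has matrix M in the basis e x;
   the cast identifies 'I_(\dim {: K x}) with 'I_n. *)
Definition matrix_locus (b : bprod K) (n : nat) (M : 'M[R[i]]_n) : set X :=
  [set x | exists xn : \dim {: K x} = n,
     forall i j, entry b i j = M (cast_ord xn i) (cast_ord xn j)].

Definition matrix_of_filter (b : bprod K) : 'M[R[i]]_dim_of_filter :=
  xget 0 [set M | F (matrix_locus b M)].

Definition rep_of_filter (b : bprod K) :
    bop ('cV[R[i]]_dim_of_filter : completeNormedModType R[i]) :=
  mx_op (matrix_of_filter b).

End RepOfFilter.

(* Main.v *)
From HB Require Import structures.
Require Import Defs.
From mathcomp Require Import all_boot all_order all_algebra complex.
From mathcomp Require Import all_classical all_reals all_analysis.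
From mathcomp Require Import ring lra.
Import Order.TTheory GRing.Theory Num.Theory numFieldNormedType.Exports.
Local Open Scope classical_set_scope.
Local Open Scope ring_scope.
Local Open Scope complex_scope.

(**
Everything rests on one fact: if [pi] is irreducible and [f : X -> C] is an
arbitrary scalar function, viewed as a central element of the product algebra,
then [f] is equal to some constant [l] on a member of the family [F_pi].
Indeed [pi f] is a bounded operator, so [pi f - l] fails to be invertible for
some [l] (bop_spectrum_neq0); if [f <> l] held on a member of [F_pi], then
[(f - l)^-1] would yield an inverse of [pi f - l] (irrep_scalar_constant). The
central idempotents [chi U] are sent to 0 or 1, which makes [F_pi] an
ultrafilter; and given sets [U k] in [F_pi], applying the fact to a function
that records some index [k] with [x] outside [U k], when there is one, gives
countable completeness (irrep_filter_sigma). Such a function may be unbounded,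
so it is essential that the product algebra is unrestricted.

Conversely, for a sigma-complete ultrafilter [F], a map from [X] to a set with a
countable separating family is constant on a member of [F] (scu_constant).
Applied to the dimension and to the matrix entries this defines [n(F)] and
[M(b)]; both the algebra operations and the uniqueness of [M(b)] are then
checked pointwise on members of [F]. As every matrix occurs as some [M(b)], an
operator commuting with [pi_F] is a scalar, so [pi_F] is irreducible.

Finally, an irreducible [pi] with [F_pi = F] annihilates each [b] that vanishes
on a member of [F]; so it factors through [b |-> M(b)], and becomes a unital
representation [rho] of a matrix algebra on a Banach space [V]. Such a
representation is a multiple of the standard one, with multiplicity space the
range of a diagonal matrix unit. A vector [v1] in that range and a continuous
functional [phi] with [phi v1 = 1] give intertwiners [S : C^n -> V] and
[T : V -> C^n] with [T S = 1]. Then [S T] is a nonzero idempotent commuting with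
[rho], hence 1 (matrix_rep_standard). Applied to [pi_F] itself, built from other
bases, this also shows the independence of the bases.

Two analytic tools are proved along the way. The nonemptiness of the spectrum
comes from an elementary argument with roots of unity instead of complex
function theory. The Hahn-Banach theorem is obtained from Zorn's lemma applied
to graphs; besides [phi], it provides the boundedness of linear maps on finite
dimensional spaces, which is needed to realize every matrix by an element of
the product algebra.
*)

Set Implicit Arguments.
Unset Strict Implicit.
Unset Printing Implicit Defensive.

(** * Real-valued norms *)

Section RealNorm.
Variables (R : realType) (V : normedModType R[i]).
Implicit Types (v w : V) (a : R[i]).

(** The norm takes its values in [R[i]], whose order is partial; [rnorm] and
    [cabs] move the estimates to the ordered field [R]. *)
Definition rnorm v : R := complex.Re `|v|.
Definition cabs a : R := complex.Re `|a|.

Lemma rnormE v : (rnorm v)%:C = `|v|.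
Proof. by rewrite /rnorm RRe_real. Qed.

Lemma cabsE a : (cabs a)%:C = `|a|.
Proof. by rewrite /cabs RRe_real. Qed.

Lemma rnorm_ge0 v : 0 <= rnorm v.
Proof. by rewrite -ler0c rnormE. Qed.

Lemma rnormD v w : rnorm (v + w) <= rnorm v + rnorm w.
Proof. by rewrite -lecR rmorphD /= !rnormE ler_normD. Qed.

Lemma rnormN v : rnorm (- v) = rnorm v.
Proof. by rewrite /rnorm normrN. Qed.

Lemma rnormZ a v : rnorm (a *: v) = cabs a * rnorm v.
Proof. by apply: complexI; rewrite rmorphM /= !rnormE cabsE normrZ. Qed.

Lemma rnorm_eq0 v : (rnorm v == 0) = (v == 0).
Proof. by rewrite -(inj_eq (@complexI _)) rnormE normr_eq0. Qed.

Lemma cabs_ge0 a : 0 <= cabs a.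
Proof. by rewrite -ler0c cabsE. Qed.

Lemma cabsM a b : cabs (a * b) = cabs a * cabs b.
Proof. by apply: complexI; rewrite rmorphM /= !cabsE normrM. Qed.

Lemma cabs_real (t : R) : cabs t%:C = `|t|.
Proof. by rewrite /cabs normc_def /= expr0n addr0 sqrtr_sqr. Qed.

End RealNorm.

Lemma bounded_opR (R : realType) (V W : normedModType R[i]) (f : V -> W) :
  bounded_op f <-> exists M : R, forall v, rnorm (f v) <= M * rnorm v.
Proof.
split=> [[M fM]|[M fM]].
  exists (cabs M) => v; rewrite -lecR rmorphM /= !rnormE cabsE.
  apply: le_trans (fM v) _.
  have := le_trans (normr_ge0 _) (fM v).
  by move=> /ger0_norm <-; rewrite normrM normr_id.
by exists M%:C => v; rewrite -!rnormE -rmorphM /= lecR.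
Qed.

(** * The spectrum of a bounded operator is not empty *)

Section BopScale.
Variables (C : numFieldType) (V : normedModType C).
Implicit Types f g : bop V.

Lemma bop_scalerAl (a : C) f g : (a *: f) * g = a *: (f * g).
Proof. exact/bopP. Qed.

Lemma bop_scalerAr (a : C) f g : f * (a *: g) = a *: (f * g).
Proof. by apply/bopP => v /=; rewrite linearZ. Qed.

Lemma bop_exprZ (a : C) f n : (a *: f) ^+ n = a ^+ n *: f ^+ n.
Proof.
elim: n => [|n IH]; first by rewrite !expr0 scale1r.
by rewrite !exprS IH bop_scalerAl bop_scalerAr scalerA.
Qed.

End BopScale.

Section Gelfand.
Variables (R : realType) (V : normedModType R[i]).
Implicit Types (f g x : bop V) (l m : R[i]).

Definition opbound f (M : R) := forall v, rnorm (f v) <= M * rnorm v.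

Lemma opbound_ex f : exists2 M : R, 0 <= M & opbound f M.
Proof.
have /bounded_opR[M fM] := bop_bounded f.
exists `|M| => // v; apply: le_trans (fM v) _.
by rewrite ler_wpM2r ?rnorm_ge0// ler_norm.
Qed.

Lemma opbound_le f M N : M <= N -> opbound f M -> opbound f N.
Proof.
move=> MN fM v; apply: le_trans (fM v) _.
by rewrite ler_wpM2r ?rnorm_ge0.
Qed.

Lemma opboundM f g M N : 0 <= M -> opbound f M -> opbound g N ->
  opbound (f * g) (M * N).
Proof.
move=> M0 fM gN v; apply: le_trans (fM _) _.
rewrite -mulrA ler_wpM2l//; exact: gN.
Qed.

Lemma opboundD f g M N : opbound f M -> opbound g N -> opbound (f + g) (M + N).
Proof.
move=> fM gN v; apply: le_trans (rnormD _ _) _.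
by rewrite mulrDl; apply: lerD; [exact: fM|exact: gN].
Qed.

Lemma opboundZ l f M : opbound f M -> opbound (l *: f) (cabs l * M).
Proof.
move=> fM v; rewrite -mulrA -[leLHS]/(rnorm (l *: f v)) rnormZ.
by rewrite ler_wpM2l ?cabs_ge0.
Qed.

Lemma half_powers x (m : nat) : opbound (x ^+ (2 ^ m)) (1 / 2) ->
  forall k, (m <= k)%N -> opbound (x ^+ (2 ^ k)) (1 / 2).
Proof.
move=> xm; elim=> [|k IH]; first by rewrite leqn0 => /eqP m0; rewrite m0 in xm.
rewrite leq_eqVlt => /predU1P[mk|/IH {}IH]; first by rewrite -mk.
rewrite expnS mulnC exprM expr2.
apply: (@opbound_le _ (1 / 2 * (1 / 2))); first by lra.
by apply: opboundM => //; lra.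
Qed.

Definition inverse_of f g := f * g = 1 /\ g * f = 1.

Variables (x : bop V) (Rs : R[i] -> bop V).
Hypothesis RsP : forall l, inverse_of (Rs l) (1 - l *: x).

Lemma resolvent_identity l m : Rs m - Rs l = (m - l) *: (Rs l * x * Rs m).
Proof.
have [_ Rm] := RsP m; have [Rl _] := RsP l.
have -> : Rs m - Rs l = Rs l * ((1 - l *: x) - (1 - m *: x)) * Rs m.
  by rewrite mulrBr mulrBl Rl mul1r -mulrA Rm mulr1.
rewrite opprB addrC addrA subrK -scalerBl.
by rewrite bop_scalerAr bop_scalerAl.
Qed.

(** The inverse of each [1 - l *: x] being given, the resolvent identity bounds
    [Rs m] by [Rs l] for [m] near [l]: the term containing [Rs m] on its
    right-hand side is absorbed. *)
Lemma resolvent_locally_bounded l : exists d C : R,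
  [/\ 0 < d, 0 <= C & forall m, cabs (m - l) <= d -> opbound (Rs m) C].
Proof.
have [N N0 xN] := opbound_ex x; have [L L0 RL] := opbound_ex (Rs l).
exists (1 / (2 * (L * N + 1))), (2 * L).
have LN0 : 0 <= L * N by rewrite mulr_ge0.
split; [by rewrite divr_gt0//; lra|by lra|move=> m ml v].
have /bopP/(_ v) E := resolvent_identity l m.
have {}E : Rs m v = Rs l v + (m - l) *: Rs l (x (Rs m v)).
  by rewrite -[(_ *: _)]E /= addrC subrK.
set u := Rs m v in E *.
have ub : rnorm u <= L * rnorm v + cabs (m - l) * (L * (N * rnorm u)).
  rewrite {1}E; apply: le_trans (rnormD _ _) _; apply: lerD; first exact: RL.
  rewrite rnormZ ler_wpM2l ?cabs_ge0//; apply: le_trans (RL _) _.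
  by rewrite ler_wpM2l.
have : cabs (m - l) * (L * N) <= 1 / 2.
  apply: (@le_trans _ _ (1 / (2 * (L * N + 1)) * (L * N))).
    by rewrite ler_wpM2r.
  rewrite mulrAC ler_pdivrMr; lra.
move=> /(ler_wpM2r (rnorm_ge0 u)).
rewrite -!mulrA.
lra.
Qed.

(** The disc is contained in the square [-1, 1]^2, which is compact. *)
Lemma resolvent_bounded_disc : exists2 C : R, 0 <= C &
  forall l, cabs l <= 1 -> opbound (Rs l) C.
Proof.
have K := compact_setX (@segment_compact R (-1) 1) (@segment_compact R (-1) 1).
move/compact_near_coveringP : K.
move=> /(_ R (pinfty_nbhs R) (fun C z => opbound (Rs (z.1 +i* z.2)) C) _).
case=> [[a b] _|].
  have [d [C [d0 C0 dC]]] := resolvent_locally_bounded (a +i* b).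
  have d20 : 0 < d / 2 by rewrite divr_gt0.
  exists ([set z | `|a - z.1| < d / 2 /\ `|b - z.2| < d / 2], [set M | C < M]).
    split => /=.
      exists ([set z | `|a - z| < d / 2], [set z | `|b - z| < d / 2]) => //=.
      by split; apply/nbhs_ballP; exists (d / 2).
    by exists C; split => //; rewrite num_real.
  move=> [[p q] M] /= [[pa qb] CM].
  apply: (opbound_le (ltW CM)); apply: dC.
  have -> : (p +i* q) - (a +i* b) = (p - a)%:C + 'i%C * (q - b)%:C by simpc.
  rewrite -lecR cabsE; apply: le_trans (ler_normD _ _) _.
  rewrite normrM -!cabsE !cabs_real -rmorphM -rmorphD /= lecR.
  rewrite /cabs normc_def /= expr0n expr1n add0r sqrtr1 mul1r.
  by rewrite distrC [X in _ + X]distrC; lra.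
move=> M [Mr MP]; exists (Num.max 0 (M + 1)); first by rewrite le_max lexx.
move=> [a b] l1; apply: (MP (Num.max 0 (M + 1)) _ (a, b)).
  by rewrite lt_max; apply/orP; right; lra.
have l2 : a ^+ 2 + b ^+ 2 <= 1.
  have : Num.sqrt (a ^+ 2 + b ^+ 2) <= 1 by move: l1; rewrite /cabs normc_def.
  by rewrite -[leRHS]sqrtr1 ler_sqrt.
split=> /=; rewrite in_itv /= -ler_norml -(expr_le1 (n := 2))// -normrX;
  rewrite ger0_norm ?sqr_ge0//.
  by apply: le_trans l2; rewrite lerDl sqr_ge0.
by apply: le_trans l2; rewrite lerDr sqr_ge0.
Qed.

(** The rotation [rot k] changes the sign of [2 ^ k]-th powers. *)
Definition rot k : R[i] := iter k (@sqrtc R) (-1).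

Lemma rotX k : rot k ^+ (2 ^ k) = -1.
Proof.
elim: k => [|k IH]; first by rewrite expr1.
by rewrite expnS exprM /rot iterS sqr_sqrtc.
Qed.

Lemma cabs_rot k : cabs (rot k) = 1.
Proof.
apply: complexI; rewrite cabsE; apply/eqP.
rewrite rmorph1 -(@pexpr_eq1 _ _ (2 ^ k)) ?expn_gt0// -normrX rotX normrN1.
exact: eqxx.
Qed.

(** The average of [Rs] over the [2 ^ k] rotations of [l] by roots of unity,
    written so that each doubling is a single mean. *)
Fixpoint power_resolvent k l : bop V :=
  if k is k'.+1 then
    2^-1 *: (power_resolvent k' l + power_resolvent k' (rot k' * l))
  else Rs l.

(** For commuting inverses, 1/(1 - a) + 1/(1 + a) = 2/(1 - a^2): each mean
    squares the operator [l *: x] that is inverted. *)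
Lemma power_resolvent_inverse k l :
  inverse_of (power_resolvent k l) (1 - l ^+ (2 ^ k) *: x ^+ (2 ^ k)).
Proof.
elim: k l => [|k IH] l; first by rewrite !expr1.
set a := l ^+ (2 ^ k) *: x ^+ (2 ^ k).
have [u1 u2] := IH l; have [v1 v2] := IH (rot k * l).
rewrite exprMn rotX mulN1r scaleNr opprK -/a in u1 u2 v1 v2.
set u := power_resolvent k l in u1 u2.
set v := power_resolvent k (rot k * l) in v1 v2.
have aE : l ^+ (2 ^ k.+1) *: x ^+ (2 ^ k.+1) = a * a.
  by rewrite expnS mulnC !exprM -bop_exprZ expr2.
have QE : power_resolvent k.+1 l = u * v.
  rewrite /= -/u -/v.
  have -> : u + v = u * ((1 - a) + (1 + a)) * v.
    by rewrite mulrDr mulrDl u1 mul1r -(mulrA u (1 + a)) v2 mulr1 addrC.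
  rewrite addrACA addNr addr0 -(mulr2n 1) mulrnAr mulr1 mulrnAl.
  by rewrite -(scaler_nat 2 (u * v)) scalerA mulVf ?scale1r// pnatr_eq0.
rewrite QE aE.
have a1 : 1 - a * a = (1 + a) * (1 - a).
  by rewrite mulrDl mul1r mulrBr mulr1 addrA subrK.
split.
  by rewrite a1 mulrA -(mulrA u) v1 mulr1 u1.
by rewrite a1 mulrA -(mulrA (1 + a)) u2 mulr1 v2.
Qed.

(** The constant does not depend on [k]: an average of increments of [Rs]
    over rotated copies of one radial segment obeys the bound for [Rs]. *)
Lemma power_resolvent_lipschitz : exists2 L : R, 0 <= L & forall k w (t t' : R),
  cabs w = 1 -> 0 <= t <= 1 -> 0 <= t' <= 1 ->
  opbound (power_resolvent k (t'%:C * w) - power_resolvent k (t%:C * w))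
    (`|t' - t| * L).
Proof.
have [C C0 RC] := resolvent_bounded_disc; have [N N0 xN] := opbound_ex x.
exists (C * N * C); first by rewrite !mulr_ge0.
have disc t w : cabs w = 1 -> 0 <= t <= 1 -> opbound (Rs (t%:C * w)) C.
  move=> w1 /andP[t0 t1]; apply: RC.
  by rewrite cabsM cabs_real w1 mulr1 ger0_norm.
elim=> [|k IH] w t t' w1 t01 t'01.
  rewrite /= resolvent_identity -mulrBl -rmorphB /=.
  have -> : `|t' - t| = cabs ((t' - t)%:C * w).
    by rewrite cabsM w1 mulr1 cabs_real.
  apply/opboundZ/opboundM; [exact: mulr_ge0| |exact: disc].
  by apply: opboundM => //; exact: disc.
rewrite /= -scalerBr opprD addrACA.
set p := `|t' - t| * (C * N * C).
have -> : p = cabs 2^-1 * (p + p).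
  suff -> : cabs (2^-1 : R[i]) = 2^-1 by lra.
  have -> : (2^-1 : R[i]) = (2^-1 : R)%:C by rewrite fmorphV /= rmorphD rmorph1.
  by rewrite cabs_real ger0_norm.
apply/opboundZ/opboundD; first exact: IH.
rewrite !(mulrCA (rot k)); apply: IH => //.
by rewrite cabsM cabs_rot mul1r.
Qed.

(** A form of the statement that [r] times the spectral radius of [x] is less
    than 1. *)
Definition half_power_at (r : R) :=
  exists k, opbound ((r%:C *: x) ^+ (2 ^ k)) (1 / 2).

(** If a power [2 ^ k] of [r x] is small, then [power_resolvent k r] is close to
    1; by the Lipschitz bound it stays close to 1 at [r'], so the same power of
    [r' x], read off from the inverse, is small as well. Since the length [d] of
    the step is uniform, iteration reaches the radius 1. *)
Lemma half_power_at_step : exists2 d : R, 0 < d & forall r r', 0 <= r <= 1 ->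
  0 <= r' <= 1 -> `|r' - r| <= d -> half_power_at r -> half_power_at r'.
Proof.
have [L L0 QL] := power_resolvent_lipschitz.
exists (1 / (10 * (L + 1))); first by apply: divr_gt0; lra.
move=> r r' r01 r'01 rd [k0 rk0]; exists k0.+2.
set k := k0.+2; set a' := _ ^+ _; set a := (r%:C *: x) ^+ (2 ^ k).
(* two more squarings turn the bound 1/2 into 1/16, small enough for [Q'1] *)
have a16 : opbound a (1 / 16).
  set y := _ ^+ _ in rk0.
  have -> : a = (y * y) * (y * y).
    rewrite -!expr2 -exprM /a /y -exprM; congr (_ ^+ _).
    by rewrite /k !expnS mulnA mulnC.
  apply: (@opbound_le _ (1 / 2 * (1 / 2) * (1 / 2 * (1 / 2)))); first by lra.
  by do !apply: opboundM => //; lra.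
have [_ Qr] := power_resolvent_inverse k r%:C.
have [Qr' _] := power_resolvent_inverse k r'%:C.
rewrite -bop_exprZ -/a in Qr; rewrite -bop_exprZ -/a' in Qr'.
have Q'1 v : rnorm (power_resolvent k r'%:C v - v) <= 1 / 6 * rnorm v.
  set q := power_resolvent k r%:C v.
  have qv : q - v = a q.
    have /bopP/(_ v) E := Qr; rewrite -{1}[v]E /=.
    by rewrite opprD opprK addrA addrN add0r.
  have qv1 : rnorm (q - v) <= 1 / 16 * rnorm q by rewrite qv; exact: a16.
  have q1 : rnorm q <= rnorm (q - v) + rnorm v.
    by rewrite -{1}(subrK v q); exact: rnormD.
  have dL : `|r' - r| * L <= 1 / 10.
    apply: (@le_trans _ _ (1 / (10 * (L + 1)) * L)); first by rewrite ler_wpM2r.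
    by rewrite mulrAC ler_pdivrMr; lra.
  have := QL k 1 r r'; rewrite !mulr1 cabs_real normr1.
  move=> /(_ erefl r01 r'01) /(opbound_le dL)/(_ v) /= q'q.
  have := rnormD (power_resolvent k r'%:C v - q) (q - v).
  rewrite addrA subrK; move: q'q.
  lra.
(* the estimate at [(1 - a') v], which [power_resolvent k r'] sends to [v] *)
move=> v.
have := Q'1 (v - a' v).
have /bopP/(_ v) /= -> := Qr'.
rewrite opprB addrC subrK.
have := rnormD v (- a' v); rewrite rnormN.
have := rnorm_ge0 v; lra.
Qed.

(** Steps of length [1 / n <= d] lead from 0, where the powers vanish, to 1. *)
Lemma half_power_at1 : half_power_at 1.
Proof.
have [d d0 step] := half_power_at_step.
pose n := (Num.truncn (1 / d)).+1.
have n0 : 0 < n%:R :> R by rewrite ltr0n.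
have nd : 1 / n%:R <= d.
  by rewrite ler_pdivrMr// mulrC -ler_pdivrMr// ltW// truncnS_gt.
suff H : forall j, (j <= n)%N -> half_power_at (j%:R / n%:R).
  by have := H n (leqnn n); rewrite divff// gt_eqF.
have j01 j : (j <= n)%N -> 0 <= (j%:R / n%:R : R) <= 1.
  by move=> jn; rewrite divr_ge0//= ler_pdivrMr// mul1r ler_nat.
elim=> [_|j IH jn].
  exists 0 => v; rewrite mul0r scale0r expr1 /rnorm /= normr0 /=.
  by rewrite mulr_ge0// rnorm_ge0.
apply: (step _ _ (j01 _ (ltnW jn)) (j01 _ jn)); last exact: IH (ltnW jn).
by rewrite -mulrBl -natrB// subSnn ger0_norm// divr_ge0.
Qed.

End Gelfand.

(** If [x - l] were invertible for all [l], then the resolvents of both [x] and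
    [y = x^-1] would be defined everywhere, so that high powers of both would be
    small, although [x ^+ n * y ^+ n = 1]. *)
Theorem bop_spectrum_neq0 (R : realType) (V : normedModType R[i]) (x : bop V) :
  (exists v : V, v != 0) ->
  exists l : R[i], ~ exists r : bop V, inverse_of r (x - l *: (1 : bop V)).
Proof.
move=> [v v0]; apply: contrapT => /forallNP noS.
have {}noS l : exists r, inverse_of r (x - l *: (1 : bop V)).
  exact: contrapT (noS l).
have resolv (z : bop V) :
    (forall l, exists r, inverse_of r (1 - l *: z)) -> half_power_at z 1.
  by move=> /choice[Rs RsP]; exact: half_power_at1 RsP.
have [y [yx xy]] := noS 0; rewrite scale0r subr0 in yx xy.
have hx : half_power_at x 1.
  apply: resolv => l; have [->|l0] := eqVneq l 0.
    by exists 1; rewrite /inverse_of scale0r subr0 mulr1.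
  have [r [rx xr]] := noS l^-1; exists (- l^-1 *: r).
  have -> : 1 - l *: x = - l *: (x - l^-1 *: (1 : bop V)).
    by rewrite scalerBr scalerA mulNr divff// scaleNr scaleN1r opprK addrC.
  split; rewrite bop_scalerAl bop_scalerAr scalerA ?rx ?xr.
    by rewrite mulrNN mulVf// scale1r.
  by rewrite mulrNN divff// scale1r.
have hy : half_power_at y 1.
  apply: resolv => l; have [r [rx xr]] := noS l; exists (r * x).
  have -> : 1 - l *: y = y * (x - l *: (1 : bop V)).
    by rewrite mulrBr yx bop_scalerAr mulr1.
  split; first by rewrite -mulrA (mulrA x) xy mul1r.
  by rewrite mulrA -(mulrA y) xr mulr1.
have [j xj] := hx; have [k yk] := hy.
rewrite !scale1r in xj yk.
have xm := half_powers xj (leq_maxl j k).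
have ym := half_powers yk (leq_maxr j k).
set n := (2 ^ _)%N in xm ym.
have xy1 : x ^+ n * y ^+ n = 1.
  rewrite -exprMn_comm ?xy ?expr1n//.
  by rewrite /GRing.comm xy yx.
have /(_ v) := opboundM (ltac:(lra) : 0 <= 1 / 2) xm ym.
rewrite xy1 /=.
have : 0 < rnorm v by rewrite lt_neqAle rnorm_ge0 eq_sym rnorm_eq0 v0.
lra.
Qed.

(** * Hahn-Banach and finite dimensional spaces *)

Section HahnBanach.
Variables (R : realType) (V : normedModType R[i]).
Implicit Types (G : set (V * R)) (v w : V).

(** Graphs of partial real-linear functionals dominated by the norm. That such a
    relation is single-valued follows from the domination. *)
Definition dominated_graph G :=
  (forall v r w s (t : R), G (v, r) -> G (w, s) ->
     G (t%:C *: v + w, t * r + s)) /\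
  (forall v r, G (v, r) -> r <= rnorm v).

(** The value [c] at [w] must lie between the numbers [r - |u - w|] and
    [|u + w| - r] for [(u, r)] in [G]; the triangle inequality leaves room for it,
    and the supremum of the former is a choice. *)
Lemma dominated_graph_extend G w : G (0, 0) -> dominated_graph G ->
  exists G', [/\ dominated_graph G', G `<=` G' & exists r, G' (w, r)].
Proof.
move=> G0 [Glin Gle].
pose A := [set p.2 - rnorm (p.1 - w) | p in G].
have Aub v r : G (v, r) -> ubound A (rnorm (v + w) - r).
  move=> Gvr _ [[u s] Gus /= <-].
  have /Gle : G (u + v, s + r).
    by have := Glin _ _ _ _ 1 Gus Gvr; rewrite scale1r mul1r.
  have := rnormD (u - w) (v + w); rewrite addrACA addNr addr0; lra.
have Asup : has_sup A.
  split; first by exists (0 - rnorm (0 - w)), (0, 0).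
  by exists (rnorm (0 + w) - 0); exact: Aub.
pose c := sup A.
have cub u s : G (u, s) -> s - rnorm (u - w) <= c.
  by move=> Gus; apply: sup_upper_bound => //; exists (u, s).
have clb v r : G (v, r) -> c <= rnorm (v + w) - r.
  by move=> Gvr; apply: ge_sup; [case: Asup|exact: Aub].
exists [set q | exists p, exists t : R,
  [/\ G p, q.1 = p.1 + t%:C *: w & q.2 = p.2 + t * c]]; split.
- split.
    move=> v r v' s t [[p1 p2] [a /= [Gp -> ->]]] [[q1 q2] [b /= [Gq -> ->]]].
    exists (t%:C *: p1 + q1, t * p2 + q2), (t * a + b); split=> /=.
    + exact: Glin.
    + by rewrite scalerDr addrACA scalerA -rmorphM -scalerDl -rmorphD.
    + by ring.
  move=> v r [[p1 p2] [t /= [Gp -> ->]]].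
  have Gs (s : R) : G (s%:C *: p1, s * p2).
    by have := Glin _ _ _ _ s Gp G0; rewrite !addr0.
  have [t0|t0|->] := ltgtP t 0.
  + have a0 : 0 < - t by rewrite oppr_gt0.
    have -> : p1 + t%:C *: w = (- t)%:C *: ((- t)^-1%:C *: p1 - w).
      rewrite scalerBr scalerA -rmorphM /= divff ?gt_eqF// scale1r.
      by rewrite rmorphN scaleNr opprK.
    rewrite rnormZ cabs_real gtr0_norm//.
    have := cub _ _ (Gs (- t)^-1).
    rewrite -(ler_pM2l a0) mulrBr mulrA divff ?gt_eqF//.
    lra.
  + have -> : p1 + t%:C *: w = t%:C *: (t^-1%:C *: p1 + w).
      by rewrite scalerDr scalerA -rmorphM /= divff ?gt_eqF// scale1r.
    rewrite rnormZ cabs_real gtr0_norm//.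
    have := clb _ _ (Gs t^-1).
    rewrite -(ler_pM2l t0) mulrBr mulrA divff ?gt_eqF//.
    lra.
  + by rewrite mul0r scale0r !addr0; exact: Gle.
- by move=> p Gp; exists p, 0; rewrite mul0r scale0r !addr0.
- by exists (0 + 1 * c), (0, 0), 1; split; rewrite //= rmorph1 scale1r add0r.
Qed.

(** Starting from the graph [G0] on the real line through [v0] forces
    [u v0 = |v0|]. *)
Lemma hahn_banach_real v0 : exists u : V -> R,
  [/\ forall (t : R) v w, u (t%:C *: v + w) = t * u v + u w,
      forall v, u v <= rnorm v & u v0 = rnorm v0].
Proof.
pose G0 := [set (t%:C *: v0, t * rnorm v0) | t in [set: R]].
pose P : set (set (V * R)) :=
  [set G | G = set0 \/ (G0 `<=` G /\ dominated_graph G)].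
(* the empty set is admitted so that empty chains have their union in [P] *)
have [F FP Ftot|G [PG Gmax]] := @Zorn_bigcup _ P.
  have [FG|FN] := pselect (exists2 G, F G & G0 `<=` G); last first.
    left; apply/seteqP; split=> // q [G FG Gq].
    case: (FP _ FG) => [G_0|[G_0 _]].
      by move: Gq; rewrite G_0.
    by case: FN; exists G.
  have [G FGG G0G] := FG; right; split.
    by apply: subset_trans G0G _ => q Gq; exists G.
  have dom H q : F H -> H q -> dominated_graph H.
    by move=> FH Hq; case: (FP _ FH) => [H0|[]//]; move: Hq; rewrite H0.
  split.
    move=> v r w s t [H FH Hv] [K FK Kw].
    have [HK|KH] := Ftot _ _ FH FK.
      by exists K => //; apply: (dom _ _ FK Kw).1 => //; exact: HK.
    by exists H => //; apply: (dom _ _ FH Hv).1 => //; exact: KH.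
  by move=> v r [H FH Hv]; apply: (dom _ _ FH Hv).2.
have G0dom : dominated_graph G0.
  split.
    move=> v r w s t [a _ [<- <-]] [b _ [<- <-]]; exists (t * a + b) => //.
    by rewrite rmorphD rmorphM scalerDl scalerA mulrDl mulrA.
  move=> v r [a _ [<- <-]]; rewrite rnormZ cabs_real ler_wpM2r ?rnorm_ge0//.
  exact: ler_norm.
have {PG} [G0G Gdom] : G0 `<=` G /\ dominated_graph G.
  case: PG => // GE; exfalso; apply: (Gmax G0); last by right; split.
  by rewrite GE; split=> // /(_ (0%:C *: v0, 0 * rnorm v0)); apply; exists 0.
have G00 : G (0, 0) by apply: G0G; exists 0; rewrite // mul0r scale0r.
have [Glin Gle] := Gdom.
have Gtot v : exists r, G (v, r).
  have [G' [G'dom GG' [r G'r]]] := dominated_graph_extend v G00 Gdom.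
  exists r; apply: contrapT => nG; apply: (Gmax G').
    by split=> // G'G; apply: nG; exact: G'G.
  by right; split=> //; exact: subset_trans GG'.
have Gfun v r s : G (v, r) -> G (v, s) -> r = s.
  move=> Gr Gs.
  have le r1 s1 : G (v, r1) -> G (v, s1) -> s1 <= r1.
    move=> Gr1 Gs1; have /Gle := Glin _ _ _ _ (-1) Gr1 Gs1.
    rewrite rmorphN rmorph1 scaleN1r addNr /rnorm normr0 /=; lra.
  by apply/eqP; rewrite eq_le !le.
have [u uG] := choice Gtot.
exists u; split.
- by move=> t v w; apply: (Gfun (t%:C *: v + w)); [exact: uG|exact: Glin].
- by move=> v; exact: Gle.
- apply: (Gfun v0); first exact: uG.
  by apply: G0G; exists 1; rewrite // mul1r scale1r.
Qed.

(** The complex functional [v |-> u v - i u (i v)] has real part [u]; the crude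
    bound [|phi v| <= 2 |v|] is enough for continuity. *)
Theorem hahn_banach_separation v0 : v0 != 0 ->
  exists phi : V -> R[i]^o,
    [/\ linear phi, bounded_op phi & phi v0 = 1].
Proof.
move=> v0N0; have [u [ulin ule uv0]] := hahn_banach_real v0.
pose phi v : R[i] := u v +i* (- u ('i *: v)).
have u0 : u 0 = 0.
  by have := ulin 1 0 0; rewrite scaler0 addr0; lra.
have uN v : u (- v) = - u v.
  by have := ulin (-1) v 0; rewrite rmorphN rmorph1 scaleN1r addr0 u0; lra.
have uD v w : u (v + w) = u v + u w.
  by have := ulin 1 v w; rewrite rmorph1 scale1r mul1r.
have uZ (t : R) v : u (t%:C *: v) = t * u v.
  by have := ulin t v 0; rewrite u0 !addr0.
have ii v : ('i : R[i]) *: ('i *: v) = - v.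
  by rewrite scalerA -expr2 sqr_i scaleN1r.
have phiD v w : phi (v + w) = phi v + phi w.
  by rewrite /phi scalerDr !uD opprD.
have phiZ a v : phi (a *: v) = a * phi v.
  rewrite /phi scalerA mulrC -scalerA; case: a => a b.
  have -> : a +i* b = a%:C + b%:C * 'i by simpc.
  rewrite !scalerDl !uD -!scalerA !uZ ii uN.
  by simpc; congr (_ +i* _); ring.
have phib v : rnorm (phi v : R[i]^o) <= 2 * rnorm v.
  have ub w : `|u w| <= rnorm w.
    by rewrite ler_norml ule andbT -lerNl -uN -rnormN ule.
  have -> : phi v = (u v)%:C + 'i * (- u ('i *: v))%:C :> R[i]^o.
    by rewrite /phi; simpc.
  apply: le_trans (rnormD _ _) _.
  have cabsi : cabs ('i : R[i]) = 1.
    by rewrite /cabs normc_def /= expr0n expr1n add0r sqrtr1.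
  have -> : rnorm ((u v)%:C : R[i]^o) = `|u v| := cabs_real _.
  have -> : rnorm ('i * (- u ('i *: v))%:C : R[i]^o) = `|u ('i *: v)|.
    by rewrite -normrN -cabs_real -[RHS]mul1r -cabsi -cabsM.
  have := ub v; have := ub ('i *: v); rewrite rnormZ cabsi mul1r; lra.
have v01 : phi v0 != 0.
  apply/eqP => /(congr1 (@complex.Re _)) /= /eqP.
  by rewrite uv0 rnorm_eq0 (negbTE v0N0).
exists (fun v => (phi v0)^-1 * phi v); split.
- by move=> a v w; rewrite phiD phiZ mulrDr mulrCA.
- apply/bounded_opR; exists (cabs (phi v0)^-1 * 2) => v.
  rewrite -mulrA.
  apply: (@le_trans _ _ (cabs (phi v0)^-1 * rnorm (phi v : R[i]^o))).
    by rewrite -[leLHS]/(cabs ((phi v0)^-1 * phi v)) cabsM.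
  by rewrite ler_wpM2l ?cabs_ge0.
- by rewrite mulVf.
Qed.

End HahnBanach.

Section FiniteDim.
Variables (R : realType) (V : finDimBanachType R[i]) (W : normedModType R[i]).

(** By induction on a subspace [U]: a continuous functional [phi] with value 1 at
    a nonzero [u0] in [U] splits [v] into [phi v *: u0] and [v - phi v *: u0], both
    controlled by [v], and the latter range over a subspace of smaller
    dimension. *)
Lemma linear_finite_dim_bounded (f : {linear V -> W}) : bounded_op f.
Proof.
suff H n : forall U : {vspace V}, (\dim U <= n)%N ->
    exists M : R, forall v, v \in U -> rnorm (f v) <= M * rnorm v.
  have [M fM] := H _ fullv (leqnn _).
  by apply/bounded_opR; exists M => v; apply: fM; rewrite memvf.
elim: n => [|n IH] U.
  rewrite leqn0 dimv_eq0 => /eqP ->; exists 0 => v; rewrite memv0 => /eqP ->.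
  by rewrite linear0 /rnorm normr0 /= mul0r.
move=> Un; have [->|UN0] := eqVneq U 0%VS; first by apply: IH; rewrite dimv0.
pose u0 := vpick U; have u0N0 : u0 != 0 by rewrite vpick0.
have [phi [philin phib phi1]] := hahn_banach_separation u0N0.
have glin : linear (fun v : V => v - (phi v : R[i]) *: u0).
  move=> a v w; rewrite philin scalerBr scalerDl opprD scalerA addrACA.
  by [].
pose g : {linear V -> V} := HB.pack (fun v : V => v - (phi v : R[i]) *: u0)
  (GRing.isLinear.Build _ _ _ _ _ glin).
have gE v : linfun g v = v - phi v *: u0 by rewrite lfunE.
have dimg : (\dim (linfun g @: U) <= n)%N.
  have := limg_ker_dim (linfun g) U.
  have : (0 < \dim (U :&: lker (linfun g)))%N.
    rewrite lt0n dimv_eq0; apply/eqP => U0.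
    have : u0 \in (U :&: lker (linfun g))%VS.
      by rewrite memv_cap memv_pick memv_ker gE phi1 scale1r subrr eqxx.
    by rewrite U0 memv0 (negbTE u0N0).
  move=> k0 kg; rewrite -ltnS; apply: leq_trans Un; rewrite -kg.
  by rewrite -addn1 addnC leq_add2r.
have [M fM] := IH _ dimg.
have /bounded_opR[L phiL] := phib.
exists (`|M| * (1 + L * rnorm u0) + L * rnorm (f u0)) => v vU.
have vE : v = g v + phi v *: u0 by rewrite /= subrK.
rewrite {1}vE linearD linearZ.
apply: le_trans (rnormD _ _) _; rewrite mulrDl; apply: lerD; last first.
  rewrite rnormZ mulrAC ler_wpM2r ?rnorm_ge0//; exact: phiL.
have gU : g v \in (linfun g @: U)%VS by rewrite -[g v]lfunE memv_img.
apply: le_trans (fM _ gU) _; rewrite -mulrA.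
apply: (@le_trans _ _ (`|M| * rnorm (g v))).
  by rewrite ler_wpM2r ?rnorm_ge0// ler_norm.
rewrite ler_wpM2l//; apply: le_trans (rnormD _ _) _.
rewrite rnormN rnormZ mulrDl mul1r lerD2l mulrAC ler_wpM2r ?rnorm_ge0//.
exact: phiL.
Qed.

End FiniteDim.

(** * Matrices along a sigma-complete ultrafilter *)

Lemma scu_inhabited (X : Type) (F : set_system X) (A B : set X) :
  sigma_complete_ultrafilter F -> F A -> F B -> exists2 x, A x & B x.
Proof.
move=> [FF _ _] FA FB.
by have [x [Ax Bx]] := filter_ex (filterI FA FB); exists x.
Qed.

(** For each [S i], the ultrafilter decides whether [h x] belongs to it; on the
    countable intersection of these decisions all values [h x] are in the same
    sets [S i], hence equal. *)
Lemma scu_constant (X Y : Type) (J : countType) (S : J -> set Y)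
    (F : set_system X) (h : X -> Y) :
  (forall y z, (forall i, S i y <-> S i z) -> y = z) ->
  sigma_complete_ultrafilter F -> exists y, F [set x | h x = y].
Proof.
move=> sep scuF; have [FF ultra sigma] := scuF.
pose U i : set X := if pselect (F (h @^-1` S i)) then h @^-1` S i
                    else ~` (h @^-1` S i).
have FU i : F (U i).
  by rewrite /U; case: pselect => // nF; case: (ultra (h @^-1` S i)).
pose W k : set X := if unpickle k is Some i then U i else setT.
have FW : F (\bigcap_k W k).
  apply: sigma => k; rewrite /W; case: unpickle => [i|]; first exact: FU.
  exact: filterT.
have [x0 Wx0] := filter_ex FW.
exists (h x0); apply: filterS FW => x Wx /=; apply: sep => i.
have := Wx (pickle i) I; have := Wx0 (pickle i) I.
by rewrite /W pickleK /U; case: pselect.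
Qed.

Lemma nat_separating (m n : nat) :
  (forall k : nat, [set k] m <-> [set k] n) -> m = n.
Proof. by move=> /(_ m)[+ _] => /(_ erefl). Qed.

Definition rat_cut (R : realType) (c : bool * rat) : set R[i] :=
  [set z | (if c.1 then complex.Re z else complex.Im z) < ratr c.2].

Lemma rat_cut_separating (R : realType) (z w : R[i]) :
  (forall c, rat_cut c z <-> rat_cut c w) -> z = w.
Proof.
move=> zw.
have key p : (if p then complex.Re z else complex.Im z) =
             (if p then complex.Re w else complex.Im w).
  set a := (LHS); set b := (RHS).
  have [ab|ba|//] := ltgtP a b.
    have [q] := rat_in_itvoo ab; rewrite in_itv /= => /andP[aq qb].
    have [+ _] := zw (p, q); rewrite /rat_cut /=.
    by move=> /(_ aq); rewrite ltNge (ltW qb).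
  have [q] := rat_in_itvoo ba; rewrite in_itv /= => /andP[bq qa].
  have [_] := zw (p, q); rewrite /rat_cut /=.
  by move=> /(_ bq); rewrite ltNge (ltW qa).
by apply/eqP; rewrite eq_complex (key true) (key false) !eqxx.
Qed.

Section Locus.
Variables (R : realType) (X : Type) (K : X -> finDimBanachType R[i]).
Variable e : forall x, (\dim {: K x}).-tuple (K x).
Implicit Types (b c : bprod K) (F : set_system X).

Lemma Omega_ex F : sigma_complete_ultrafilter F -> exists n, F (Omega K n).
Proof. exact: scu_constant nat_separating. Qed.

Lemma Omega_unique F m n : sigma_complete_ultrafilter F ->
  F (Omega K m) -> F (Omega K n) -> m = n.
Proof. by move=> scuF Fm Fn; have [x <-] := scu_inhabited scuF Fm Fn. Qed.

Lemma dim_of_filterP F : sigma_complete_ultrafilter F ->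
  F (Omega K (dim_of_filter K F)).
Proof.
move=> /Omega_ex[n Fn].
exact: (@xgetPex _ 0%N [set n | F (Omega K n)] (ex_intro _ n Fn)).
Qed.

Lemma matrix_locus_ex F n b : sigma_complete_ultrafilter F ->
  F (Omega K n) -> exists M : 'M[R[i]]_n, F (matrix_locus e b M).
Proof.
move=> scuF Fn.
pose h x : 'M[R[i]]_n := if pselect (\dim {: K x} = n) is left xn then
  \matrix_(i, j) entry e b (cast_ord (esym xn) i) (cast_ord (esym xn) j) else 0.
have [|M FM] := @scu_constant X _ _
  (fun c : 'I_n * 'I_n * (bool * rat) =>
     [set M : 'M[R[i]]_n | rat_cut c.2 (M c.1.1 c.1.2)]) F h _ scuF.
  move=> M N MN; apply/matrixP => i j; apply: rat_cut_separating => c.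
  exact: (MN (i, j, c)).
have [FF _ _] := scuF.
exists M; apply: filterS2 Fn FM => x xn <-.
exists xn => i j; rewrite /h; case: pselect => // xn'.
by rewrite mxE (eq_irrelevance xn' xn) !cast_ordK.
Qed.

Lemma matrix_locus_dim b n (M : 'M[R[i]]_n) : matrix_locus e b M `<=` Omega K n.
Proof. by move=> x []. Qed.

Lemma matrix_locus_fun b n (M N : 'M[R[i]]_n) x :
  matrix_locus e b M x -> matrix_locus e b N x -> M = N.
Proof.
move=> [xn bM] [xn' bN]; rewrite (eq_irrelevance xn' xn) in bN.
apply/matrixP => i j.
have := bM (cast_ord (esym xn) i) (cast_ord (esym xn) j).
by rewrite bN !cast_ordKV.
Qed.

Lemma matrix_of_filterP F b : sigma_complete_ultrafilter F ->
  F (matrix_locus e b (matrix_of_filter F e b)).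
Proof.
move=> scuF; have [M FM] := matrix_locus_ex b scuF (dim_of_filterP scuF).
exact: (@xgetPex _ 0 [set M | F (matrix_locus e b M)] (ex_intro _ M FM)).
Qed.

Lemma matrix_of_filterE F b M : sigma_complete_ultrafilter F ->
  F (matrix_locus e b M) -> matrix_of_filter F e b = M.
Proof.
move=> scuF FM.
have [x] := scu_inhabited scuF (matrix_of_filterP b scuF) FM.
exact: matrix_locus_fun.
Qed.

Lemma matrix_locus_linear a b c n (M N : 'M[R[i]]_n) x :
  matrix_locus e b M x -> matrix_locus e c N x ->
  matrix_locus e (a *: b + c) (a *: M + N) x.
Proof.
move=> [xn bM] [xn' cN]; rewrite (eq_irrelevance xn' xn) in cN.
by exists xn => i j; rewrite !mxE -bM -cN /entry /= linearP.
Qed.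

Hypothesis e_basis : is_basis_family e.

Lemma entry_sum b x (j : 'I_(\dim {: K x})) :
  b x (tnth (e x) j) = \sum_i entry e b i j *: tnth (e x) i.
Proof.
rewrite {1}(coord_basis (e_basis x) (memvf (b x _))).
by apply: eq_bigr => i _; rewrite -tnth_nth.
Qed.

Lemma matrix_locus_mul b c n (M N : 'M[R[i]]_n) x :
  matrix_locus e b M x -> matrix_locus e c N x ->
  matrix_locus e (b * c) (M *m N) x.
Proof.
move=> [xn bM] [xn' cN]; rewrite (eq_irrelevance xn' xn) in cN.
exists xn; subst n => i j; rewrite !mxE {1}/entry /=.
rewrite entry_sum linear_sum linear_sum /=.
apply: eq_bigr => k _; rewrite linearZ linearZ /= mulrC.
by rewrite -[coord _ _ _]/(entry e b i k) bM cN !cast_ord_id.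
Qed.

Lemma matrix_locus1 n x : Omega K n x -> matrix_locus e 1 (1%:M : 'M[R[i]]_n) x.
Proof.
move=> xn; exists xn => i j.
rewrite mxE (inj_eq (@cast_ord_inj _ _ _)) /entry /= (tnth_nth 0) coord_free.
  by rewrite eq_sym.
exact: basis_free (e_basis x).
Qed.

Lemma matrix_locus_eq b c n (M : 'M[R[i]]_n) x :
  matrix_locus e b M x -> matrix_locus e c M x -> b x = c x.
Proof.
move=> [xn bM] [xn' cM]; rewrite (eq_irrelevance xn' xn) in cM.
apply/bopP => v; rewrite (coord_basis (e_basis x) (memvf v)) !linear_sum.
apply: eq_bigr => j _; rewrite !linearZ -tnth_nth /= !entry_sum.
by congr (_ *: _); apply: eq_bigr => i _; rewrite bM cM.
Qed.

Definition matrix_fun n (M : 'M[R[i]]_n) x (xn : \dim {: K x} = n) (v : K x) :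
    K x :=
  \sum_i (\sum_j M (cast_ord xn i) (cast_ord xn j) * coord (e x) j v)
    *: tnth (e x) i.

Lemma matrix_fun_linear n (M : 'M[R[i]]_n) x (xn : \dim {: K x} = n) :
  linear (matrix_fun M xn).
Proof.
move=> a v w; rewrite scaler_sumr -big_split; apply: eq_bigr => i _ /=.
rewrite scalerA -scalerDl mulr_sumr -big_split; congr (_ *: _).
by apply: eq_bigr => j _ /=; rewrite linearP /= mulrDr mulrCA.
Qed.

Lemma matrix_fun_bounded n (M : 'M[R[i]]_n) x (xn : \dim {: K x} = n) :
  bounded_op (matrix_fun M xn).
Proof.
pose g : {linear K x -> K x} := HB.pack (matrix_fun M xn)
  (GRing.isLinear.Build _ _ _ _ _ (matrix_fun_linear M xn)).
exact: (linear_finite_dim_bounded g).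
Qed.

(** An element of the product algebra with matrix [M] at each point of dimension
    [n]; this is what makes [b |-> M(b)] surjective. *)
Definition lift_matrix n (M : 'M[R[i]]_n) : bprod K := fun x =>
  if pselect (\dim {: K x} = n) is left xn
  then Bop (matrix_fun_linear M xn) (matrix_fun_bounded M xn) else 0.

Lemma lift_matrixP n (M : 'M[R[i]]_n) :
  Omega K n `<=` matrix_locus e (lift_matrix M) M.
Proof.
move=> x xn; exists xn => i j; rewrite /entry /lift_matrix.
case: pselect => // xn'; rewrite (eq_irrelevance xn' xn) /= /matrix_fun.
have cE k l : coord (e x) k (tnth (e x) l) = (l == k)%:R.
  by rewrite (tnth_nth 0) coord_free ?(basis_free (e_basis x)).
rewrite linear_sum (bigD1 i)//= linearZ /= cE eqxx mulr1.
rewrite [X in _ + X]big1 => [|k ki]; last first.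
  by rewrite linearZ /= cE (negbTE ki) mulr0.
rewrite addr0 (bigD1 j)//= cE eqxx mulr1 big1 ?addr0//.
by move=> k kj; rewrite cE eq_sym (negbTE kj) mulr0.
Qed.

End Locus.

(** * The ultrafilter of an irreducible representation *)

Section FilterOfRep.
Variables (R : realType) (X : Type) (K : X -> finDimBanachType R[i]).
Variables (V : completeNormedModType R[i]) (pi : bprod K -> bop V).
Hypothesis pi_irr : irreducible_rep pi.
Implicit Types (b c : bprod K) (U : set X).

Let F : set_system X := [set U | pi (chi K U) = 1].

Let pi_linear : linear pi. Proof. by case: pi_irr => _ []. Qed.

HB.instance Definition _ :=
  GRing.isLinear.Build R[i] (bprod K) (bop V) *:%R pi pi_linear.

Lemma irrep1 : pi 1 = 1. Proof. by case: pi_irr => _ [_ []]. Qed.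

Lemma irrepM : {morph pi : b c / b * c}. Proof. by case: pi_irr => _ [_ []]. Qed.

Lemma irrep_nontrivial : (1 : bop V) <> 0.
Proof.
have [[v v0] _ _] := pi_irr.
by move=> /bopP/(_ v) /= /eqP; rewrite (negbTE v0).
Qed.

Lemma chiT : chi K setT = 1.
Proof. by apply: functional_extensionality_dep => x; rewrite /chi in_setT. Qed.

Lemma chi0 : chi K set0 = 0.
Proof. by apply: functional_extensionality_dep => x; rewrite /chi in_set0. Qed.

Lemma chiC U : chi K (~` U) = 1 - chi K U.
Proof.
apply: functional_extensionality_dep => x; rewrite /chi in_setC.
rewrite -[RHS]/(1 - (if x \in U then 1 else 0)).
by case: (x \in U); rewrite /= ?subrr ?subr0.
Qed.

Lemma chiI U W : chi K (U `&` W) = chi K U * chi K W.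
Proof.
apply: functional_extensionality_dep => x; rewrite /chi in_setI.
rewrite -[RHS]/((if x \in U then 1 else 0) * (if x \in W then 1 else 0)).
by case: (x \in U); case: (x \in W); rewrite /= ?mulr1 ?mulr0.
Qed.

Lemma chi_comm U b : GRing.comm (chi K U) b.
Proof.
apply: functional_extensionality_dep => x.
rewrite -[LHS]/((if x \in U then 1 else 0) * b x).
rewrite -[RHS]/(b x * (if x \in U then 1 else 0)).
by case: (x \in U); rewrite ?mulr1 ?mul1r ?mulr0 ?mul0r.
Qed.

Lemma irrep_chi01 U : pi (chi K U) = 0 \/ pi (chi K U) = 1.
Proof.
have [_ _ irr] := pi_irr; apply: irr.
  by rewrite -irrepM -chiI setIid.
by move=> b; rewrite /GRing.comm -!irrepM chi_comm.
Qed.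

Lemma irrep_filter_ultra U : F U \/ F (~` U).
Proof.
have [U0|U1] := irrep_chi01 U; [right|by left].
by rewrite /F /= chiC linearB /= irrep1 U0 subr0.
Qed.

Lemma irrep_filter_proper : ProperFilter F.
Proof.
have FS U W : U `<=` W -> F U -> F W.
  move=> UW; rewrite /F /= => FU.
  by rewrite -[pi _]mul1r -{1}FU -irrepM -chiI (setIidl UW).
apply: Build_ProperFilter_ex => [U|].
  move=> FU; apply: contrapT => nU; apply: irrep_nontrivial.
  move: FU; rewrite /F /= => <-; rewrite (_ : U = set0) ?chi0 ?linear0//.
  by apply/seteqP; split=> // x Ux; apply: nU; exists x.
split.
- by rewrite /F /= chiT irrep1.
- by move=> U W; rewrite /F /= chiI irrepM => -> ->; rewrite mulr1.
- exact: FS.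
Qed.

Lemma irrep_eq_on b c U : F U -> (forall x, U x -> b x = c x) -> pi b = pi c.
Proof.
rewrite /F /= => FU bc.
rewrite -[pi b]mulr1 -[pi c]mulr1 -FU -!irrepM; congr (pi _).
apply: functional_extensionality_dep => x.
rewrite -[LHS]/(b x * (if x \in U then 1 else 0)).
rewrite -[RHS]/(c x * (if x \in U then 1 else 0)).
by case: (boolP (x \in U)) => [/set_mem/bc ->|_]; rewrite ?mulr0.
Qed.

(** This is where the spectrum is used: outside the set where [f = l], the
    function [f - l] is invertible among scalar functions. *)
Lemma irrep_scalar_constant (f : X -> R[i]) :
  exists l, F [set x | f x = l].
Proof.
have [[v v0] _ _] := pi_irr.
pose sc (g : X -> R[i]) : bprod K := fun x => g x *: (1 : bop (K x)).
have scM g h x : (sc g * sc h) x = (g x * h x) *: (1 : bop (K x)).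
  rewrite -[LHS]/(sc g x * sc h x) /sc bop_scalerAl bop_scalerAr.
  by rewrite mulr1 scalerA.
have [l nl] := @bop_spectrum_neq0 R V (pi (sc f)) (ex_intro _ v v0).
exists l; have [//|FU] := irrep_filter_ultra [set x | f x = l].
case: nl; exists (pi (sc (fun x => (f x - l)^-1))).
have -> : pi (sc f) - l *: (1 : bop V) = pi (sc (fun x => f x - l)).
  rewrite -irrep1 -linearZ -linearB; congr (pi _).
  apply: functional_extensionality_dep => x.
  by rewrite -[LHS]/(f x *: (1 : bop (K x)) - l *: (1 : bop (K x))) -scalerBl.
split; rewrite -irrepM -irrep1; apply: (irrep_eq_on FU) => x /= /eqP fl.
  by rewrite scM mulVf ?subr_eq0// scale1r.
by rewrite scM mulfV ?subr_eq0// scale1r.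
Qed.

(** The function [f] is 0 on the intersection of the [U k], and [k.+1] at a point
    outside [U k] for the chosen [k]; so a nonzero constant value would put the
    complement of some [U k] into the filter. *)
Lemma irrep_filter_sigma : sigma_complete_ultrafilter F.
Proof.
split; [exact: irrep_filter_proper|exact: irrep_filter_ultra|move=> U FU].
have FF := irrep_filter_proper.
pose f x : R[i] := if pselect (exists k, ~ U k x) is left ex
                   then (sval (cid ex)).+1%:R else 0.
have [l Fl] := irrep_scalar_constant f.
have [l0|l0] := pselect (l = 0).
  apply: filterS Fl => x /=; rewrite /f l0; case: pselect => [ex|nex _ k _].
    by move=> /eqP; rewrite pnatr_eq0.
  by apply: contrapT => nU; apply: nex; exists k.
have [x0 /= x0l] := filter_ex Fl.
move: (x0l); rewrite /f; case: pselect => [ex0 kl|_ /esym//].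
have [x [/= xl]] := filter_ex (filterI Fl (FU (sval (cid ex0)))).
move: xl; rewrite /f; case: pselect => [ex|_ /esym//].
rewrite -kl => /eqP; rewrite eqr_nat => /eqP[kE].
by have := svalP (cid ex); rewrite kE => /[apply].
Qed.

End FilterOfRep.

(** * Irreducible representations of matrix algebras, and pi_F *)

Section MatrixRep.
Variables (R : realType) (n : nat).
Local Notation C := R[i].
Local Notation Cn := ('cV[C]_n : completeNormedModType C).

Lemma cV_norm_le (u : Cn) j : `|u j 0| <= `|u|.
Proof.
rewrite [leRHS]/Num.Def.normr /= mx_normE -[leLHS]nngE num_le.
exact: (le_bigmax _ _ (j, 0)).
Qed.

Lemma cV_norm_sum (u : Cn) : `|u| <= \sum_i `|u i 0|.
Proof.
rewrite [leLHS]/Num.Def.normr /=; have [->|] := eqVneq (mx_norm u) 0.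
  exact: sumr_ge0.
move=> /mx_norm_neq0[[i k] ->] /=; rewrite (ord1 k) (bigD1 i)//= lerDl.
exact: sumr_ge0.
Qed.

Variables (V : completeNormedModType C) (rho : {linear 'M[C]_n -> bop V}).
Hypotheses (rhoM : forall M N, rho (M *m N) = rho M * rho N)
  (rho1 : rho 1%:M = 1).
Hypothesis rho_irr : forall p : bop V, p * p = p ->
  (forall M, GRing.comm p (rho M)) -> p = 0 \/ p = 1.

Local Notation E := (@delta_mx C n n).

Lemma rho_delta M k j : rho M * rho (E k j) = \sum_i M i k *: rho (E i j).
Proof.
rewrite -rhoM {1}(matrix_sum_delta M) mulmx_suml linear_sum.
apply: eq_bigr => i _.
rewrite mulmx_suml linear_sum (bigD1 k)//= -scalemxAl mul_delta_mx linearZ /=.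
rewrite big1 ?addr0// => l lk.
by rewrite -scalemxAl mul_delta_mx_cond (negbTE lk) mulr0n scaler0 linear0.
Qed.

Lemma delta_rho M k j : rho (E j k) * rho M = \sum_i M k i *: rho (E j i).
Proof.
rewrite -rhoM {1}(matrix_sum_delta M) mulmx_sumr linear_sum (bigD1 k)//=.
rewrite [X in _ + X]big1 ?addr0 => [|l lk]; last first.
  rewrite mulmx_sumr big1 ?linear0// => i _.
  by rewrite -scalemxAr mul_delta_mx_cond eq_sym (negbTE lk) mulr0n scaler0.
rewrite mulmx_sumr linear_sum; apply: eq_bigr => i _.
by rewrite -scalemxAr mul_delta_mx linearZ.
Qed.

Lemma bop_sumE (I : finType) (f : I -> bop V) v : (\sum_i f i) v = \sum_i f i v.
Proof. by elim/big_rec2: _ => // i u w _ <-. Qed.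

(** The matrix units [E i i0] carry a vector [v1] in the range of [E i0 i0] to
    vectors [e i] that span a copy of [C^n], and [T] reads off coordinates by
    transporting a vector back to the range of [E i0 i0] and applying [phi] there. *)
Theorem matrix_rep_standard : (exists v : V, v != 0) ->
  exists (T : {linear V -> Cn}) (S : {linear Cn -> V}),
    [/\ bounded_op T, bounded_op S, cancel T S, cancel S T &
        forall M v, T (rho M v) = M *m T v].
Proof.
move=> [v v0].
have [i0 [w v1N0]] : exists i0 w, rho (E i0 i0) w != 0.
  apply: contrapT => nE; case/eqP: v0.
  have /bopP/(_ v) /= <- := rho1.
  rewrite (_ : 1%:M = \sum_i E i i); last first.
    apply/matrixP => a b; rewrite mxE summxE (bigD1 a)//= mxE eqxx eq_sym.
    by rewrite big1 ?addr0// => c ca; rewrite mxE (eq_sym a) (negbTE ca).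
  rewrite linear_sum bop_sumE big1// => i _; apply: contrapT => /eqP Ei.
  by apply: nE; exists i, v.
pose v1 := rho (E i0 i0) w.
have [phi0 [philin phib phi1]] := hahn_banach_separation v1N0.
pose phi : {linear V -> C^o} :=
  HB.pack phi0 (GRing.isLinear.Build _ _ _ _ _ philin).
have rE j k l m : rho (E j k) * rho (E l m) = (k == l)%:R *: rho (E j m).
  by rewrite -rhoM mul_delta_mx_cond linearMn scaler_nat.
pose e i := rho (E i i0) v1.
have ei0 : e i0 = v1.
  by have /bopP/(_ w) := rE i0 i0 i0 i0; rewrite eqxx scale1r.
pose S0 (c : Cn) : V := \sum_i c i 0 *: e i.
pose T0 (u : V) : Cn := \col_i (phi (rho (E i0 i) u) : C).
have S0lin : linear S0.
  move=> a c d; rewrite scaler_sumr -big_split; apply: eq_bigr => i _.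
  by rewrite !mxE scalerDl scalerA.
have T0lin : linear T0.
  by move=> a c d; apply/colP => i; rewrite !mxE !linearP.
have S0b : bounded_op S0.
  exists (\sum_i `|e i|) => c; rewrite mulr_suml.
  apply: le_trans (ler_norm_sum _ _ _) _; apply: ler_sum => i _.
  by rewrite normrZ mulrC ler_wpM2l// cV_norm_le.
have T0b : bounded_op T0.
  have /choice[m mP] i :
      exists m, forall u, `|phi (rho (E i0 i) u)| <= m * `|u|.
    exact: (@bounded_op_comp _ _ _ _ phi (rho (E i0 i)) phib (bop_bounded _)).
  exists (\sum_i m i) => u; apply: le_trans (cV_norm_sum _) _.
  by rewrite mulr_suml; apply: ler_sum => i _; rewrite mxE.
pose S : {linear Cn -> V} := HB.pack S0 (GRing.isLinear.Build _ _ _ _ _ S0lin).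
pose T : {linear V -> Cn} := HB.pack T0 (GRing.isLinear.Build _ _ _ _ _ T0lin).
have ST : cancel S T.
  move=> c; apply/colP => i; rewrite mxE /= /S0.
  have rEe j : rho (E i0 i) (e j) = (i == j)%:R *: v1.
    by rewrite -[in RHS]ei0; have /bopP/(_ v1) := rE i0 i j i0.
  rewrite linear_sum (bigD1 i)//= linearZ /= rEe eqxx scale1r.
  rewrite big1 => [|j ji]; last first.
    by rewrite linearZ /= rEe eq_sym (negbTE ji) scale0r scaler0.
  rewrite addr0 -[phi0 _]/(phi _) linearZ.
  rewrite -[phi v1]/(phi0 (rho (E i0 i0) w)) phi1.
  exact: mulr1.
have TM M u : T (rho M u) = M *m T u.
  apply/colP => i; rewrite !mxE.
  have /bopP/(_ u) /= -> := delta_rho M i i0.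
  rewrite bop_sumE -[phi0 _]/(phi _) linear_sum; apply: eq_bigr => k _.
  by rewrite mxE linearZ.
have SM M c : S (M *m c) = rho M (S c).
  rewrite /= /S0 linear_sum /=.
  under [RHS]eq_bigr => k _.
    rewrite linearZ /=.
    have /bopP/(_ v1) /= -> := rho_delta M k i0.
    rewrite bop_sumE scaler_sumr.
    over.
  rewrite exchange_big; apply: eq_bigr => i _.
  rewrite mxE scaler_suml; apply: eq_bigr => k _.
  by rewrite mulrC -scalerA.
have STlin : linear (S0 \o T0) by move=> a u u'; rewrite /= T0lin S0lin.
pose P : bop V := Bop STlin (@bounded_op_comp _ _ _ _ S T S0b T0b).
have PP : P * P = P by apply/bopP => u; congr S0; exact: ST.
have Pcomm M : GRing.comm P (rho M).
  by apply/bopP => u; rewrite -[RHS]SM; congr S0; exact: TM.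
exists T, S; split=> //.
have [P0|P1] := rho_irr PP Pcomm; last by move=> u; have /bopP/(_ u) := P1.
case/eqP: v1N0; rewrite -[LHS]/v1 -ei0.
have -> : e i0 = S (delta_mx i0 0).
  rewrite /= /S0 (bigD1 i0)//= mxE !eqxx scale1r big1 ?addr0// => j ji.
  by rewrite mxE (negbTE ji) scale0r.
rewrite -[X in S X]ST.
by have /bopP/(_ (S (delta_mx i0 0))) := P0.
Qed.

End MatrixRep.

Section RepOfFilter.
Variables (R : realType) (X : Type) (K : X -> finDimBanachType R[i]).
Variable e : forall x, (\dim {: K x}).-tuple (K x).
Hypothesis e_basis : is_basis_family e.
Variable F : set_system X.
Hypothesis scuF : sigma_complete_ultrafilter F.
Implicit Types b c : bprod K.

#[local] Instance scu_proper_filter : ProperFilter F.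
Proof. by case: scuF. Qed.

Local Notation n := (dim_of_filter K F).
Local Notation mof := (matrix_of_filter F e).

Lemma matrix_of_filter_linear a b c : mof (a *: b + c) = a *: mof b + mof c.
Proof.
apply: matrix_of_filterE => //.
apply: filterS2 (matrix_of_filterP e b scuF) (matrix_of_filterP e c scuF) => x.
exact: matrix_locus_linear.
Qed.

Lemma matrix_of_filterM b c : mof (b * c) = mof b *m mof c.
Proof.
apply: matrix_of_filterE => //.
apply: filterS2 (matrix_of_filterP e b scuF) (matrix_of_filterP e c scuF) => x.
exact: matrix_locus_mul.
Qed.

Lemma matrix_of_filter1 : mof 1 = 1%:M.
Proof.
apply: matrix_of_filterE => //; apply: filterS (dim_of_filterP K scuF) => x.
exact: matrix_locus1.
Qed.

Lemma matrix_of_filter_lift M : mof (lift_matrix e M) = M.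
Proof.
apply: matrix_of_filterE => //; apply: filterS (dim_of_filterP K scuF).
exact: lift_matrixP.
Qed.

Lemma matrix_of_filter_eq_on b c : F [set x | b x = c x] -> mof b = mof c.
Proof.
move=> Fbc; apply/esym/matrix_of_filterE => //.
apply: filterS2 Fbc (matrix_of_filterP e b scuF) => x /= bc [xn bM].
by exists xn => i j; rewrite -bM /entry bc.
Qed.

Lemma matrix_of_filter_chi1 U : F U -> mof (chi K U) = 1%:M.
Proof.
move=> FU; rewrite -matrix_of_filter1; apply: matrix_of_filter_eq_on.
by apply: filterS FU => x Ux /=; rewrite /chi mem_set.
Qed.

Lemma matrix_of_filter_chi0 U : F (~` U) -> mof (chi K U) = 0.
Proof.
move=> FU; have -> : (0 : 'M[R[i]]_n) = mof 0.
  have := matrix_of_filter_linear (-1) 0 0.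
  by rewrite scaler0 addr0 scaleN1r addNr.
apply: matrix_of_filter_eq_on.
by apply: filterS FU => x Ux /=; rewrite /chi memNset.
Qed.

Lemma rep_of_filter_representation : representation (rep_of_filter F e).
Proof.
split; first by move=> a b c; apply/bopP => v /=;
  rewrite matrix_of_filter_linear mulmxDl scalemxAl.
split=> [|b c]; apply/bopP => v /=.
  by rewrite matrix_of_filter1 mul1mx.
by rewrite matrix_of_filterM mulmxA.
Qed.

(** Every matrix occurs, in particular [u *m delta_mx 0 i0] which maps the basis
    vector [d] to [u]; so an operator in the commutant is determined by its value
    at [d], and only the [i0] coordinate [a] of that value matters. *)
Lemma rep_of_filter_irreducible : irreducible (rep_of_filter F e).
Proof.
move=> p pp pcomm.
have pM M u : p (M *m u) = M *m p u.
  have /bopP/(_ u) /= := pcomm (lift_matrix e M).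
  by rewrite matrix_of_filter_lift.
have [n0|n0] := posnP n.
  left; apply/bopP => v; apply/colP => i.
  by have := ltn_ord i; rewrite {2}n0.
pose i0 : 'I_n := Ordinal n0.
pose d : 'cV[R[i]]_n := delta_mx i0 0.
pose a := (delta_mx 0 i0 *m p d : 'M[R[i]]_1) 0 0.
have pa u : p u = a *: u.
  have uE : u = (u *m delta_mx 0 i0) *m d.
    by rewrite -mulmxA mul_delta_mx -[LHS]mulmx1; congr (_ *m _);
       apply/matrixP => i j; rewrite !ord1 !mxE.
  rewrite {1}uE pM -mulmxA [_ *m p d]mx11_scalar -/a.
  by rewrite mul_mx_scalar.
have aa : a * a = a.
  have /bopP/(_ d) := pp; rewrite /= !pa scalerA => /colP/(_ i0).
  by rewrite !mxE !eqxx !mulr1.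
have : a * (a - 1) = 0 by rewrite mulrBr aa mulr1 subrr.
move=> /eqP; rewrite mulf_eq0 subr_eq0 => /orP[] /eqP a01; [left|right].
  by apply/bopP => u; rewrite pa a01 scale0r.
by apply/bopP => u; rewrite pa a01 scale1r.
Qed.

Hypothesis K_neq0 : forall x, exists v : K x, v != 0.

Lemma dim_of_filter_gt0 : (0 < n)%N.
Proof.
have [x /= <-] := filter_ex (dim_of_filterP K scuF).
rewrite lt0n dimv_eq0; apply/eqP => K0; have [v] := K_neq0 x.
by have := memvf v; rewrite K0 memv0 => /eqP ->; rewrite eqxx.
Qed.

Lemma rep_of_filter_irreducible_rep : irreducible_rep (rep_of_filter F e).
Proof.
split; [|exact: rep_of_filter_representation|exact: rep_of_filter_irreducible].
exists (const_mx 1); apply/eqP => /colP/(_ (Ordinal dim_of_filter_gt0)).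
by rewrite !mxE => /eqP; rewrite oner_eq0.
Qed.

Lemma filter_of_rep_of_filter U : rep_of_filter F e (chi K U) = 1 <-> F U.
Proof.
have [_ ultra _] := scuF.
split=> [U1|FU]; last first.
  by apply/bopP => v; rewrite /= matrix_of_filter_chi1// mul1mx.
have [//|FU] := ultra U.
have [[v v0] _ _] := rep_of_filter_irreducible_rep; case/eqP: v0.
have /bopP/(_ v) /= <- := U1.
by rewrite matrix_of_filter_chi0// mul0mx.
Qed.

End RepOfFilter.

(** * The correspondence *)

Section Correspondence.
Variables (R : realType) (X : Type) (K : X -> finDimBanachType R[i]).

Lemma filter_of_rep_equiv (pi rho : irrep K) :
  rep_equiv pi rho -> filter_of_rep pi = filter_of_rep rho.
Proof.
have sub (s t : irrep K) :
    rep_equiv s t -> filter_of_rep s `<=` filter_of_rep t.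
  move=> [T [S [_ _ _ SK TE]]] U; rewrite /filter_of_rep /= => sU.
  by apply/bopP => v; rewrite -{1}(SK v) -TE sU /= SK.
by move=> st; apply/seteqP; split; apply: sub => //; exact: rep_equiv_sym.
Qed.

Lemma filter_of_rep_sigma (pi : irrep K) :
  sigma_complete_ultrafilter (filter_of_rep pi).
Proof. exact: irrep_filter_sigma (irrepP pi). Qed.

(** Two elements with the same matrix on a member of the filter have the same
    image under [pi]; so [pi] is the composite of [b |-> M(b)] with a
    representation [rho] of the matrix algebra. *)
Lemma irrep_equiv_rep_of_filter (pi : irrep K)
    (e : forall x, (\dim {: K x}).-tuple (K x)) (e_basis : is_basis_family e)
    (piF : irreducible_rep (rep_of_filter (filter_of_rep pi) e)) :
  rep_equiv pi (Irrep piF).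
Proof.
have scuF := filter_of_rep_sigma pi.
have [FF _ _] := scuF.
have FO := dim_of_filterP K scuF.
have [nz [pilin pimul] irr] := irrepP pi.
have irr_eq := irrep_eq_on (irrepP pi).
set F := filter_of_rep pi in scuF FF FO piF irr_eq *.
pose rho0 (M : 'M[R[i]]_(dim_of_filter K F)) := pi (lift_matrix e M).
have piE b M : F (matrix_locus e b M) -> pi b = rho0 M.
  move=> FbM; apply: (irr_eq _ _ _ FbM) => x bM.
  apply: (matrix_locus_eq e_basis bM); apply: lift_matrixP => //.
  exact: matrix_locus_dim bM.
have lP (M : 'M[R[i]]_(dim_of_filter K F)) :
    F (matrix_locus e (lift_matrix e M) M).
  by apply: filterS FO; exact: lift_matrixP.
have rho_lin : linear rho0.
  move=> a M N; rewrite -pilin; apply/esym/piE.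
  by apply: filterS2 (lP M) (lP N) => x; exact: matrix_locus_linear.
pose rho : {linear 'M[R[i]]_(dim_of_filter K F) -> bop (irrep_space pi)} :=
  HB.pack rho0 (GRing.isLinear.Build _ _ _ _ _ rho_lin).
have [] := @matrix_rep_standard R _ _ rho _ _ _ nz.
- move=> M N; rewrite -[RHS]pimul; apply/esym/piE.
  by apply: filterS2 (lP M) (lP N) => x; exact: matrix_locus_mul.
- rewrite -[RHS]pimul.1; apply/esym/piE.
  by apply: filterS FO => x; exact: matrix_locus1.
- move=> p pp pcomm; apply: irr => // b.
  by rewrite (piE _ _ (matrix_of_filterP e b scuF)); exact: pcomm.
move=> T [S [Tb Sb TK SK TE]]; exists T, S; split=> // b v.
by rewrite (piE _ _ (matrix_of_filterP e b scuF)) [LHS]TE.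
Qed.

End Correspondence.

Theorem theorem2p6 (R : realType) (X : Type) (K : X -> finDimBanachType R[i])
    (K_neq0 : forall x, exists v : K x, v != 0) :
  [/\ (* n(F) and M(b) are well defined *)
      forall F : set_system X, sigma_complete_ultrafilter F ->
        exists! n : nat, F (Omega K n),
      forall (F : set_system X) (e : forall x, (\dim {: K x}).-tuple (K x)),
        sigma_complete_ultrafilter F -> is_basis_family e ->
        forall b : bprod K,
          exists! M : 'M[R[i]]_(dim_of_filter K F), F (matrix_locus e b M)
    & (* the two assignments are well defined and inverse to each other *)
      exists (Phi : rep_class K -> sigma_ultrafilter X)
             (Psi : sigma_ultrafilter X -> rep_class K),
        [/\ forall pi : irrep K, sval (Phi (class_of pi)) = filter_of_rep pi,
            forall (F : sigma_ultrafilter X)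
                   (e : forall x, (\dim {: K x}).-tuple (K x)),
              is_basis_family e ->
              exists piF_irr : irreducible_rep (rep_of_filter (sval F) e),
                Psi F = class_of (Irrep piF_irr),
            cancel Phi Psi
          & cancel Psi Phi]].
Proof.
split.
- move=> F scuF; have [n Fn] := Omega_ex K scuF; exists n; split=> // m.
  exact: Omega_unique.
- move=> F e scuF _ b; exists (matrix_of_filter F e b); split.
    exact: matrix_of_filterP.
  by move=> M; exact: matrix_of_filterE.
pose e0 x : (\dim {: K x}).-tuple (K x) := vbasis fullv.
have e0b : is_basis_family e0 by move=> x; exact: vbasisP.
pose rep (E : rep_class K) : irrep K := sval (cid (svalP E)).
have repE E : class_of (rep E) = E.
  by rewrite /rep; case: E => P ex; case: cid => pi /= PE; exact: eq_exist.
pose Phi E : sigma_ultrafilter X := exist _ _ (filter_of_rep_sigma (rep E)).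
pose piF (F : sigma_ultrafilter X) e (eb : is_basis_family e) : irrep K :=
  Irrep (rep_of_filter_irreducible_rep eb (svalP F) K_neq0).
pose Psi F := class_of (piF F e0 e0b).
have PhiE pi : sval (Phi (class_of pi)) = filter_of_rep pi.
  by apply/filter_of_rep_equiv/class_ofP; exact: repE.
have piFK F e eb : filter_of_rep (piF F e eb) = sval F.
  apply/seteqP; split=> U.
    by move/(filter_of_rep_of_filter eb (svalP F) K_neq0).
  by move=> FU; apply/(filter_of_rep_of_filter eb (svalP F) K_neq0).
have piF_unique pi F e eb :
    filter_of_rep pi = sval F -> rep_equiv pi (piF F e eb).
  case: F => F scuF /= FE; case: F / FE in scuF *.
  exact: irrep_equiv_rep_of_filter.
exists Phi, Psi; split=> //.
- move=> F e eb; exists (irrepP (piF F e eb)); apply/class_ofP.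
  by apply: piF_unique; exact: piFK.
- move=> E; rewrite -[RHS]repE; apply/class_ofP/rep_equiv_sym.
  exact: piF_unique.
- have sigma_ultrafilter_inj (G H : sigma_ultrafilter X) :
      sval G = sval H -> G = H.
    by case: G H => G sG [H sH] /= GH; exact: eq_exist.
  move=> F; apply: sigma_ultrafilter_inj.
  by rewrite -[RHS](piFK F e0 e0b); exact: PhiE.
Qed.
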